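(* For every integer $k\ge 2$, the even cycle $C_{2k}$ is $\{1,2,\ldots,k-1\}$-distance magic.
   Context: $C_n$ denotes the cycle on $n\ge 3$ vertices. Let $G=(V,E)$ be a finite simple undirected graph with $v=|V|$ vertices, and let $d(x,y)$ be the graph distance. For a set $D$ of nonnegative integers and $x\in V$, put $N_D(x)=\{y\in V : d(x,y)\in D\}$. A $D$-distance magic labeling of $G$ is a bijection $f:V\to\{1,2,\ldots,v\}$ for which there is a constant $\mathsf{k}$ such that $\sum_{y\in N_D(x)} f(y)=\mathsf{k}$ for every $x\in V$. $G$ is called $D$-distance magic if it admits a $D$-distance magic labeling. *)

(* Defs.v *)
From mathcomp Require Import all_boot.

Set Implicit Arguments.
Unset Strict Implicit.
Unset Printing Implicit Defensive.

Record sgraph := SGraph {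
  vertex :> finType;
  adj : rel vertex;
  adj_sym : symmetric adj;
  adj_irr : irreflexive adj
}.

Definition has_walk (G : sgraph) (x y : G) (n : nat) : bool :=
  [exists p : n.-tuple G, path (@adj G) x p && (last x p == y)].

(* Graph distance, with [None] standing for infinity: the length of a shortest
   walk from x to y.  Only lengths below #|G| need to be searched; see
   [gdistP]. *)
Definition gdist (G : sgraph) (x y : G) : option nat :=
  let n := find (has_walk x y) (iota 0 #|G|) in
  if n < #|G| then Some n else None.

Lemma has_walk_short (G : sgraph) (x y : G) (n : nat) :
  has_walk x y n -> exists2 m, m <= n & (m < #|G|) && has_walk x y m.
Proof.
case/existsP=> p /andP[xp /eqP <-].
case/shortenP: xp => p' xp' up' sub.
exists (size p').
  by rewrite -[n in _ <= n](size_tuple p); apply: uniq_leq_size sub; case/andP: up'.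
rewrite -[size p']/(size (x :: p')).-1 /= -[(size p').+1]/(size (x :: p')).
rewrite -(card_uniqP up') max_card /=.
by apply/existsP; exists (in_tuple p'); rewrite xp' eqxx.
Qed.

Lemma gdistP (G : sgraph) (x y : G) (n : nat) :
  gdist x y = Some n <->
  has_walk x y n /\ (forall m, has_walk x y m -> n <= m).
Proof.
rewrite /gdist; set l := iota 0 #|G|; set a := has_walk x y.
have sl : size l = #|G| by rewrite size_iota.
have min m : a m -> find a l <= m.
  case/has_walk_short=> j jm /andP[jG aj]; apply: leq_trans jm.
  rewrite leqNgt; apply/negP=> /(before_find 0).
  by rewrite nth_iota // add0n /a aj.
have ex m : a m -> a (find a l) /\ find a l < #|G|.
  case/has_walk_short=> j _ /andP[jG aj].
  have hl : has a l by apply/hasP; exists j; rewrite ?mem_iota.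
  have fl : find a l < #|G| by rewrite -sl -has_find.
  by split=> //; have := nth_find 0 hl; rewrite nth_iota.
split.
  case: ifP => // fl [<-]; split=> //.
  by have := @nth_find _ 0 a l; rewrite has_find sl nth_iota //; apply.
case=> an mn; have [af ->] := ex _ an.
by congr Some; apply/eqP; rewrite eqn_leq min // mn.
Qed.

Definition dist_nbhd (G : sgraph) (D : {pred nat}) (x : G) : {set G} :=
  [set y | if gdist x y is Some n then n \in D else false].

Definition labeling (G : sgraph) (f : G -> nat) : Prop :=
  [/\ injective f,
      forall x, 1 <= f x <= #|G| &
      forall i, 1 <= i <= #|G| -> exists x, f x = i].

Definition distance_magic_labeling (G : sgraph) (D : {pred nat})
    (f : G -> nat) : Prop :=
  labeling f /\
  exists c : nat, forall x : G, \sum_(y in dist_nbhd D x) f y = c.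

Definition distance_magic (G : sgraph) (D : {pred nat}) : Prop :=
  exists f : G -> nat, distance_magic_labeling D f.

(* The conjunct [i != j] only matters when n = 1, where it discards the loop;
   the graph is the cycle C_n for n >= 3. *)
Definition cycle_adj (n : nat) (i j : 'I_n) : bool :=
  (i != j) && ((j == i.+1 %% n :> nat) || (i == j.+1 %% n :> nat)).

Lemma cycle_adj_sym n : symmetric (@cycle_adj n).
Proof. by move=> i j; rewrite /cycle_adj eq_sym orbC. Qed.

Lemma cycle_adj_irr n : irreflexive (@cycle_adj n).
Proof. by move=> i; rewrite /cycle_adj eqxx. Qed.

Definition cycle_graph (n : nat) : sgraph :=
  SGraph (@cycle_adj_sym n) (@cycle_adj_irr n).

(* Main.v *)
Require Import Defs.
From mathcomp Require Import all_boot.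
From mathcomp Require Import zify.

(** In the cycle C_(2k) the distance between two vertices is the length of the
    shorter of the two arcs joining them ([gdist_cycle]).  It is therefore at
    most k, and equals k only for antipodal vertices.  Hence the vertices at
    distance 1, ..., k-1 from x are all vertices except x and its antipode
    ([mem_dist_nbhd_even_cycle]), and a labeling is magic as soon as the sum
    of the labels of two antipodal vertices does not depend on the pair.
    Pairing the labels 1, ..., 2k as {i, 2k+1-i} achieves this: label one half
    of the cycle increasingly by 1, ..., k and give the antipode of the vertex
    labeled i the label 2k+1-i.

    The distance formula is obtained from a characterization of the distance
    to a fixed vertex ([gdist_eq_of_potential]), which avoids exhibiting
    shortest walks explicitly. *)

Set Implicit Arguments.
Unset Strict Implicit.
Unset Printing Implicit Defensive.

(** The distance to y is the only function vanishing exactly at y that drops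
    by at most 1 along each edge and is nowhere locally minimal except at y:
    the bounded drop makes it a lower bound for the length of any walk to y,
    and following descending edges yields a walk no longer than its value. *)
Lemma gdist_eq_of_potential (G : sgraph) (y : G) (h : G -> nat) :
  (forall a, (h a == 0) = (a == y)) ->
  (forall a b, adj a b -> h a <= (h b).+1) ->
  (forall a, a != y -> exists2 b, adj a b & h b < h a) ->
  forall x, gdist x y = Some (h x).
Proof.
move=> h0 hlip hdesc x.
have lower m a : has_walk a y m -> h a <= m.
  case/existsP=> p /andP[ap /eqP lp].
  rewrite -(size_tuple p); elim: (tval p) a ap lp => [|b s IHs] a /=.
    by move=> _ ay; rewrite leqn0 h0 ay.
  case/andP=> ab bs ls; apply: leq_trans (hlip _ _ ab) _.
  by rewrite ltnS; apply: IHs.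
apply/gdistP; split=> [|m]; last exact: lower.
(* Strong induction on a bound for h x; the lower bound just proved forces the
   descending walk to have length exactly h x. *)
have upper N a : h a <= N ->
    exists p, [/\ path (@adj G) a p, last a p = y & size p <= h a].
  elim: N a => [|N IHN] a.
    rewrite leqn0 h0 => /eqP ->.
    by exists [::].
  have [-> _|ay haN] := eqVneq a y; first by exists [::].
  have [b ab hba] := hdesc a ay.
  have [|p [bp lp sp]] := IHN b; first by rewrite -ltnS (leq_trans hba).
  by exists (b :: p); rewrite /= ab bp lp; split=> //; apply: leq_ltn_trans hba.
have [p [xp lp sp]] := upper _ x (leqnn _).
have w : has_walk x y (size p).
  by apply/existsP; exists (in_tuple p); rewrite xp lp eqxx.
have -> : h x = size p by apply/eqP; rewrite eqn_leq sp (lower _ _ w).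
exact: w.
Qed.

(** The truncated differences add up to the absolute difference. *)
Definition arc_dist (n i j : nat) : nat :=
  let d := (i - j) + (j - i) in minn d (n - d).

Lemma succ_modnE n i : i < n -> i.+1 %% n = if i.+1 == n then 0 else i.+1.
Proof.
move=> lt_in; case: eqP => [->|ne]; first exact: modnn.
by rewrite modn_small //; lia.
Qed.

Lemma cycle_adjE n (i j : 'I_n) :
  cycle_adj i j =
  [&& (i != j :> nat) &
      ((j == (if i.+1 == n then 0 else i.+1) :> nat)
       || (i == (if j.+1 == n then 0 else j.+1) :> nat))].
Proof. by rewrite /cycle_adj -!succ_modnE. Qed.

Lemma gdist_cycle n (x y : cycle_graph n) :
  gdist x y = Some (arc_dist n (x : 'I_n) (y : 'I_n)).
Proof.
move: x y => /= x y; have ltyn := ltn_ord y.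
apply: (@gdist_eq_of_potential (cycle_graph n) y
          (fun a : 'I_n => arc_dist n a y)) => [a|a b|a] /=.
- have ltan := ltn_ord a.
  by rewrite -[RHS]val_eqE /= /arc_dist; lia.
- have ltan := ltn_ord a; have ltbn := ltn_ord b.
  by rewrite cycle_adjE /arc_dist; case: (a.+1 =P n); case: (b.+1 =P n); lia.
rewrite -val_eqE /= => ne_ay; have ltan := ltn_ord a.
have lt_up : (if a.+1 == n then 0 else a.+1) < n by case: eqP; lia.
have lt_dn : (if a == 0 :> nat then n.-1 else a.-1) < n by case: eqP; lia.
(* One of the two neighbors of a is the next vertex on a shorter arc to y. *)
have [dec|dec] : arc_dist n (Ordinal lt_up) y < arc_dist n a y \/
                 arc_dist n (Ordinal lt_dn) y < arc_dist n a y.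
- by rewrite /arc_dist /=; do 2!case: eqP; lia.
- exists (Ordinal lt_up) => //; rewrite cycle_adjE /=.
  by do !case: eqP => //=; lia.
exists (Ordinal lt_dn) => //; rewrite cycle_adjE /=.
by do !case: eqP => //=; lia.
Qed.

Lemma antipode_subproof k (i : 'I_(2 * k)) :
  (if i < k then i + k else i - k) < 2 * k.
Proof. by have := ltn_ord i; case: (ltnP i k); lia. Qed.

Definition antipode k (i : 'I_(2 * k)) : 'I_(2 * k) :=
  Ordinal (antipode_subproof i).

(** Two vertices at arc distance d are joined by arcs of lengths d and 2k - d,
    so d <= k, with equality exactly when both arcs have length k. *)
Lemma mem_dist_nbhd_even_cycle k (x y : cycle_graph (2 * k)) :
  (y \in dist_nbhd [pred d : nat | 1 <= d <= k - 1] x)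
  = (y != x) && (y != antipode x).
Proof.
rewrite inE gdist_cycle inE; move: x y => /= x y.
have := ltn_ord x; have := ltn_ord y.
by rewrite -!val_eqE /= /arc_dist; case: (ltnP x k); lia.
Qed.

(** The vertex opposite to j < k is j + k, and 3k - (j + k) = (2k + 1) - (j + 1)
    is the complement of the label of j. *)
Definition antipodal_label k (i : 'I_(2 * k)) : nat :=
  if i < k then i.+1 else 3 * k - i.

Lemma antipodal_label_sum k (i : 'I_(2 * k)) :
  antipodal_label i + antipodal_label (antipode i) = (2 * k).+1.
Proof.
have lti := ltn_ord i; rewrite /antipodal_label /=.
by case: (ltnP i k) => ?; case: ltnP; lia.
Qed.

Lemma antipodal_label_labeling k :
  @labeling (cycle_graph (2 * k)) (@antipodal_label k).
Proof.
rewrite /labeling card_ord; split=> [i j|i|m hm] /=.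
- have lti := ltn_ord i; have ltj := ltn_ord j.
  rewrite /antipodal_label => eq_ij; apply: val_inj => /=.
  by move: eq_ij; case: (ltnP i k); case: (ltnP j k); lia.
- by have := ltn_ord i; rewrite /antipodal_label; case: (ltnP i k); lia.
have lt_m : (if m <= k then m.-1 else 3 * k - m) < 2 * k.
  by case: (leqP m k); lia.
exists (Ordinal lt_m); rewrite /antipodal_label /=.
by case: (leqP m k) => ?; case: ltnP; lia.
Qed.

Theorem theorem2 (k : nat) (hk : 2 <= k) :
  distance_magic (cycle_graph (2 * k)) [pred d : nat | 1 <= d <= k - 1].
Proof.
exists (@antipodal_label k); split; first exact: antipodal_label_labeling.
exists (\sum_(y : 'I_(2 * k)) antipodal_label y - (2 * k).+1) => x.
have ne_anti : antipode x != x.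
  by have := ltn_ord x; rewrite -val_eqE /=; case: (ltnP x k); lia.
rewrite (eq_bigl _ _ (mem_dist_nbhd_even_cycle x)).
rewrite [in RHS](bigD1 x) //= [in RHS](bigD1 (antipode x)) //=.
by rewrite addnA antipodal_label_sum addKn.
Qed.
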